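(* Let $A, B\in\mathbb{C}^{n\times n}$ and $D\in\mathbb{C}^{k\times k}$ be Hermitian with $B$ positive definite. Let $\lambda_1\le\lambda_2\le\cdots\le\lambda_n$ be the eigenvalues of the pencil $A-\lambda B$, with $U\in\mathbb{C}^{n\times n}$ such that $U^{\mathrm{H}}AU=\operatorname{diag}(\lambda_1,\ldots,\lambda_n)$ and $U^{\mathrm{H}}BU=I_n$. Let $Q\in\mathbb{C}^{k\times k}$ be unitary with $Q^{\mathrm{H}}DQ=\Omega=\operatorname{diag}(\omega_1,\ldots,\omega_k)$, where $\omega_1\ge\cdots\ge\omega_\ell\ge 0\ge\omega_{\ell+1}\ge\cdots\ge\omega_k$ for some $0\le \ell\le k$. Then $$\min_{X\in\mathbb{C}^{n\times k},\,X^{\mathrm{H}}BX=I_k}\operatorname{trace}(DX^{\mathrm{H}}AX)=\sum_{i=1}^{\ell}\omega_i\lambda_i+\sum_{i=\ell+1}^k\omega_i\lambda_{i+n-k}.$$ Furthermore, any minimizer $X_{\mathrm{opt}}$ satisfies: (a) If $D$ is nonsingular, then $\mathcal{R}(X_{\mathrm{opt}}Q)$ is the eigenspace of $A-\lambda B$ associated with its $\ell$ smallest and $k-\ell$ largest eigenvalues. If moreover all $\omega_i$ are distinct, then $(X_{\mathrm{opt}}Q)^{\mathrm{H}}AX_{\mathrm{opt}}Q=\operatorname{diag}(\lambda_1,\ldots,\lambda_\ell,\lambda_{n-k+\ell+1},\ldots,\lambda_n)$. (b) Suppose $D$ (possibly singular) has $\ell_+$ positive and $\ell_-$ negative eigenvalues,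 and let $\widehat Q\in\mathbb{C}^{k\times(\ell_++\ell_-)}$ consist of the first $\ell_+$ and last $\ell_-$ columns of $Q$. Then $\mathcal{R}(X_{\mathrm{opt}}\widehat Q)$ is the eigenspace of $A-\lambda B$ associated with its $\ell_+$ smallest and $\ell_-$ largest eigenvalues. If moreover the nonzero eigenvalues of $D$ are distinct, then $(X_{\mathrm{opt}}\widehat Q)^{\mathrm{H}}AX_{\mathrm{opt}}\widehat Q=\operatorname{diag}(\lambda_1,\ldots,\lambda_{\ell_+},\lambda_{n-\ell_-+1},\ldots,\lambda_n)$.
   Context: $X^{\mathrm{H}}$ denotes conjugate transpose, $\mathcal{R}(\cdot)$ the column space (range), and $k\le n$. ''Eigenspace associated with a set of eigenvalues'' means the subspace spanned by eigenvectors $u$ ($Au=\lambda Bu$) of the pencil corresponding to those eigenvalues. *)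

(* Defs.v *)
From HB Require Import structures.
From mathcomp Require Export all_boot all_order all_algebra.
From mathcomp Require Export sesquilinear spectral.
Set Implicit Arguments.
Unset Strict Implicit.
Unset Printing Implicit Defensive.
Import Order.TTheory GRing.Theory Num.Theory.
Local Open Scope ring_scope.

(* Conventions.  Matrices are over a numeric closed field C (e.g. the complex
   numbers).  M ^t* is the conjugate transpose (notation from spectral.v, in
   sesquilinear_scope).  Indices are 0-based: the paper's lambda_i is
   [lam (i-1)]. *)

Section Defs.
Variable C : numClosedFieldType.

(* Hermitian matrix: A^H = A. *)
Definition hermitianmx n (A : 'M[C]_n) : Prop := (A ^t*)%sesqui = A.

(* Hermitian positive definite. *)
Definition posdefmx n (B : 'M[C]_n) : Prop :=
  hermitianmx B /\
  forall x : 'cV[C]_n, x != 0 -> 0 < ((x ^t*)%sesqui *m B *m x) 0 0.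

(* extension of a finite family [f : 'I_n -> C] to nat indices (0 outside). *)
Definition ext n (f : 'I_n -> C) (j : nat) : C :=
  if insub j is Some i then f i else 0.

(* The "first p and last m" eigenvalues (0-based), as a row of size q
   (always used with q = p + m):
   entry j is lam_j for j < p and lam_(n - m + (j - p)) otherwise. *)
Definition extreme_eigs n (lam : 'I_n -> C) (p m q : nat) : 'rV[C]_q :=
  \row_(j < q) (if (j < p)%N then ext lam j else ext lam (n - m + (j - p))).

(* Selection matrix S : 'M_(k, q) such that Q *m S consists of the first p
   and the last m columns of Q : 'M_(k, k) (when p + m <= k). *)
Definition sel_idx (k p m : nat) (j : nat) : nat :=
  if (j < p)%N then j else (k - m + (j - p))%N.

Definition colsel (k p m q : nat) : 'M[C]_(k, q) :=
  \matrix_(c < k, j < q) ((nat_of_ord c == sel_idx k p m j)%:R).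

(* Column spaces (ranges) of two matrices with n rows coincide. *)
Definition same_range n r s (M : 'M[C]_(n, r)) (N : 'M[C]_(n, s)) : bool :=
  (M^T == N^T)%MS.

End Defs.

(* Main.v *)
Require Import Defs.
From mathcomp Require Import zify.
Set Implicit Arguments.
Unset Strict Implicit.
Unset Printing Implicit Defensive.
Import Order.TTheory GRing.Theory Num.Theory.
Local Open Scope ring_scope.
Local Open Scope sesquilinear_scope.

(* With [W := U^-1 X Q] the constraint becomes [W^H W = 1] and the objective
   [\sum_j omega_j a_j], where [a_j = \sum_i lam_i |W_ij|^2].  The columns with
   [omega_j > 0] and those with [omega_j < 0] are treated separately, the latter
   after replacing [lam] and [omega] by their opposites.  Writing positive
   weights as a sum over their level sets reduces the bound to Ky Fan's
   inequality for each level set.  At a minimizer every one of these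
   inequalities is an equality: then the rows of [W] with [lam_i] beyond the
   extreme threshold vanish on the level set, and those strictly below it have
   norm one, which forces the span of the columns to be an eigenspace. *)

(** * Matrices with orthonormal columns, and completion to a unitary matrix *)

Section Isometry.
Variables (C : numClosedFieldType) (n p : nat) (W : 'M[C]_(n, p)).
Hypothesis W_iso : W ^t* *m W = 1%:M.

Lemma isometry_col j : \sum_i `|W i j| ^+ 2 = 1.
Proof.
have := congr1 (fun M : 'M_p => M j j) W_iso; rewrite !mxE eqxx mulr1n => <-.
by apply: eq_bigr => i _; rewrite !mxE normCKC.
Qed.

(** [P = W W^H] is an orthogonal projection: the left side is [P i i], and computing it from
    [P = P P] gives squared moduli because [P] is Hermitian. *)
Lemma isometry_proj_norm i :
  \sum_j `|W i j| ^+ 2 = \sum_i' `|\sum_j W i' j * (W i j)^*| ^+ 2.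
Proof.
pose P := W *m W ^t*.
have PE a b : P a b = \sum_j W a j * (W b j)^*.
  by rewrite mxE; apply: eq_bigr => j _; rewrite !mxE.
have PP : P *m P = P by rewrite /P mulmxA -(mulmxA W) W_iso mulmx1.
transitivity (P i i).
  by rewrite PE; apply: eq_bigr => j _; rewrite normCK.
rewrite -{1}PP mxE; apply: eq_bigr => i' _.
rewrite -PE normCKC; congr (_ * _).
rewrite !PE rmorph_sum; apply: eq_bigr => j _.
by rewrite rmorphM /= conjCK mulrC.
Qed.

(** With [P = W W^H], the square of [P i i] is one of the nonnegative terms that sum to [P i i]. *)
Lemma isometry_row_le1 i : \sum_j `|W i j| ^+ 2 <= 1.
Proof.
set x := \sum_j _.
have x0 : 0 <= x by apply: sumr_ge0 => j _; rewrite exprn_ge0.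
have xx : x * x <= x.
  rewrite {3}/x isometry_proj_norm (bigD1 i) //= -[_ * _]addr0.
  apply: lerD; last by apply: sumr_ge0 => j _; rewrite exprn_ge0.
  suff -> : \sum_j W i j * (W i j)^* = x by rewrite (ger0_norm x0) expr2.
  by apply: eq_bigr => j _; rewrite normCK.
have [->|xn0] := eqVneq x 0; first exact: ler01.
by rewrite -(@ler_pM2l _ x) ?mulr1 // lt0r xn0.
Qed.

(** When [P i i = 1], the diagonal term exhausts the sum of squares, so the other entries of column
    [i] of [P = W W^H] vanish. *)
Lemma isometry_row_ortho i i' : \sum_j `|W i j| ^+ 2 = 1 -> i' != i ->
  \sum_j W i' j * (W i j)^* = 0.
Proof.
move=> x1 ne; have := isometry_proj_norm i.
rewrite (bigD1 i) //= x1.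
have -> : \sum_j W i j * (W i j)^* = 1.
  by rewrite -[RHS]x1; apply: eq_bigr => j _; rewrite normCK.
rewrite normr1 expr1n => /esym/eqP.
rewrite -subr_eq0 addrAC subrr add0r => /eqP s0.
have /psumr_eq0P/(_ s0 i' ne)/eqP :
    forall a, a != i -> 0 <= `|\sum_j W a j * (W i j)^*| ^+ 2.
  by move=> a _; rewrite exprn_ge0.
by rewrite sqrf_eq0 normr_eq0 => /eqP.
Qed.

End Isometry.

(** Induction on the number of rows outside [J]: one such row is replaced by a unit vector
    orthogonal to the rows in [J]. *)
Lemma unitary_completion (C : numClosedFieldType) p (G : 'M[C]_p)
    (J : {set 'I_p}) :
  {in J &, forall a b, \sum_c G a c * (G b c)^* = (a == b)%:R} ->
  exists2 N : 'M[C]_p, N \is unitarymx & {in J, forall j c, N j c = G j c}.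
Proof.
have [m] := ubnP #|~: J|; elim: m G J => // m IH G J ltJ GJ.
have [/eqP JT|/set0Pn[j0 ]] := boolP (~: J == set0).
  have inJ a : a \in J by have := in_set0 a; rewrite -JT inE => /negbFE.
  exists G => //; apply/unitarymxP/matrixP => a b.
  rewrite !mxE -(GJ a b (inJ a) (inJ b)).
  by apply: eq_bigr => c _; rewrite !mxE.
rewrite inE => j0J.
(* Row [j0] of [M] is zero, so [M] is singular; a kernel vector, conjugated and normalised, becomes
   the new row [j0]. *)
pose M := \matrix_(i, c) (if i \in J then G i c else 0).
have /eqP/det0P[v v0 vM] : \det M^T = 0.
  rewrite det_tr (expand_det_row M j0) big1 // => c _.
  by rewrite mxE (negPf j0J) mul0r.
pose s := \sum_c `|v 0 c| ^+ 2.
have s0 : 0 < s.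
  rewrite lt0r sumr_ge0 ?andbT => [|c _]; last by rewrite exprn_ge0.
  apply: contra v0 => /eqP sE; apply/eqP/rowP => c; rewrite mxE.
  have /psumr_eq0P/(_ sE c isT)/eqP : forall c, true -> 0 <= `|v 0 c| ^+ 2.
    by move=> ? _; rewrite exprn_ge0.
  by rewrite sqrf_eq0 normr_eq0 => /eqP.
have rs0 : 0 < sqrtC s by rewrite sqrtC_gt0.
pose G' := \matrix_(i, c) (if i == j0 then (v 0 c)^* / sqrtC s else G i c).
have vort a : a \in J -> \sum_c G a c * v 0 c = 0.
  move=> aJ; have := congr1 (fun X : 'rV_p => X 0 a) vM.
  rewrite !mxE => vMa; rewrite -[RHS]vMa.
  by apply: eq_bigr => c _; rewrite !mxE aJ mulrC.
have rsc : (sqrtC s)^* = sqrtC s by apply/CrealP/ger0_real/ltW.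
have [|a b|N Nu NG] := IH G' (j0 |: J).
- rewrite -ltnS; apply: leq_trans ltJ; rewrite ltnS.
  apply: proper_card.
  by rewrite properE !setCS subsetUr subUset sub1set (negPf j0J).
- have ort x : x \in J -> \sum_c G x c * ((v 0 c)^* / sqrtC s)^* = 0.
    move=> xJ; transitivity ((\sum_c G x c * v 0 c) / sqrtC s).
      rewrite mulr_suml; apply: eq_bigr => c _.
      by rewrite rmorphM fmorphV /= conjCK rsc mulrA.
    by rewrite vort // mul0r.
  rewrite !inE; case: (eqVneq a j0) => [->|aj];
    case: (eqVneq b j0) => [->|bj] /=.
  + move=> _ _; rewrite ?eqxx.
    transitivity (\sum_c `|v 0 c| ^+ 2 / s); last first.
      by rewrite -mulr_suml divff ?gt_eqF.
    apply: eq_bigr => c _; rewrite !mxE eqxx rmorphM fmorphV /= conjCK rsc.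
    by rewrite mulrACA -normCKC -invfM -expr2 sqrtCK.
  + move=> _ bJ; rewrite ?(negPf bj).
    transitivity ((\sum_c G b c * ((v 0 c)^* / sqrtC s)^*)^*).
      rewrite rmorph_sum; apply: eq_bigr => c _; rewrite !mxE eqxx (negPf bj).
      by rewrite [in RHS]rmorphM /= conjCK mulrC.
    by rewrite ort // rmorph0.
  + move=> aJ _; rewrite ?(negPf aj) -[RHS](ort _ aJ).
    by apply: eq_bigr => c _; rewrite !mxE eqxx (negPf aj).
  + move=> aJ bJ; rewrite -GJ //; apply: eq_bigr => c _.
    by rewrite !mxE (negPf aj) (negPf bj).
exists N => // j jJ c; rewrite NG ?inE ?jJ ?orbT // mxE.
by case: eqP => // jj; rewrite -jj jJ in j0J.
Qed.

(** * Level sets of the weights and Ky Fan's inequality *)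

(* Layer-cake decomposition of the weights: peel off the smallest weight, which
   multiplies the sum of [f] over all of [S], and recurse on the rest. *)
Lemma weighted_sum_ge0 (R : numDomainType) (I : finType) (f w : I -> R)
    (S : {set I}) :
  {in S, forall j, 0 < w j} ->
  {in S, forall t, 0 <= \sum_(j in S | w t <= w j) f j} ->
  0 <= \sum_(j in S) w j * f j /\
  (\sum_(j in S) w j * f j = 0 ->
   {in S, forall t, \sum_(j in S | w t <= w j) f j = 0}).
Proof.
have [m] := ubnP #|S|; elim: m w S => // m IH w S ltS wS fS.
have [->|[t0 t0S]] := set_0Vmem S.
  by rewrite big_set0; split=> // _ t; rewrite inE.
have wr : {in S, forall j, w j \is Num.real} by move=> j /wS/gtr0_real.
case: (real_arg_minP t0S wr) => t tS tmin.
pose S' := [set j in S | w t < w j].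
pose w' j := w j - w t.
(* Subtracting [w t] preserves the order, so the recursion meets level sets of the original [w]. *)
have lev u : u \in S' -> \sum_(j in S' | w' u <= w' j) f j
    = \sum_(j in S | w u <= w j) f j.
  rewrite inE => /andP[uS tu]; apply: eq_bigl => j; rewrite inE lerBlDr subrK.
  case: (boolP (w u <= w j)) => [uj|]; rewrite ?andbF ?andbT //.
  by rewrite (lt_le_trans tu) ?andbT.
have [|j|u uS'|ge0 eq0] := IH w' S'.
- rewrite -ltnS; apply: leq_trans ltS; rewrite ltnS; apply: proper_card.
  apply/properP; split; first by apply/subsetP => j; rewrite inE => /andP[].
  by exists t; rewrite // inE ltxx andbF.
- by rewrite inE subr_gt0 => /andP[].
- by rewrite lev //; apply: fS; move: uS'; rewrite inE => /andP[].
have levt u : u \in S -> w u = w t ->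
    \sum_(j in S | w u <= w j) f j = \sum_(j in S) f j.
  move=> uS ->; apply: eq_bigl => j.
  by case: (boolP (j \in S)) => //= jS; apply: tmin.
have -> : \sum_(j in S) w j * f j
    = w t * \sum_(j in S) f j + \sum_(j in S') w' j * f j.
  rewrite mulr_sumr [X in _ = _ + X](_ : _ = \sum_(j in S) w' j * f j).
    rewrite -big_split /=; apply: eq_bigr => j _.
    by rewrite -mulrDl addrC subrK.
  rewrite [RHS](bigID (fun j => w t < w j)) /= [X in _ = _ + X]big1 ?addr0.
    by apply: eq_bigl => j; rewrite inE.
  move=> j /andP[jS]; rewrite -real_leNgt ?wr // => jt.
  suff -> : w' j = 0 by rewrite mul0r.
  by apply/eqP; rewrite subr_eq0 eq_le jt; apply: tmin.
have fS0 : 0 <= w t * \sum_(j in S) f j.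
  by rewrite pmulr_rge0 ?wS // -(levt t) // fS.
split; first exact: addr_ge0.
move=> /eqP; rewrite paddr_eq0 // => /andP[/eqP e1 /eqP e2] u uS.
have [ut|ut] := eqVneq (w u) (w t).
  by apply/eqP; rewrite levt //; move/eqP: e1; rewrite mulf_eq0 gt_eqF ?wS.
by rewrite -lev ?eq0 // inE uS lt_neqAle eq_sym ut; apply: tmin.
Qed.

(* Every term of
   [\sum_i (lam i - mu) * (mass of row i in J - (i \in sigma @: J))]
   is nonnegative, and this sum is the difference of the two sides. *)
Lemma ky_fan (C : numClosedFieldType) n p (W : 'M[C]_(n, p)) (lam : 'I_n -> C)
    (sigma : 'I_p -> 'I_n) (J : {set 'I_p}) (mu : C) :
  W ^t* *m W = 1%:M -> injective sigma ->
  (forall i, lam i \is Num.real) ->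
  {in J, forall j, lam (sigma j) <= mu} ->
  (forall i, i \notin sigma @: J -> mu <= lam i) ->
  let d := \sum_(j in J) (\sum_i lam i * `|W i j| ^+ 2 - lam (sigma j)) in
  0 <= d /\
  (d = 0 -> forall i,
     (lam i < mu -> \sum_(j in J) `|W i j| ^+ 2 = 1) /\
     (mu < lam i -> \sum_(j in J) `|W i j| ^+ 2 = 0)).
Proof.
move=> Wi sI lr lamJ lamN d.
pose q i : C := \sum_(j in J) `|W i j| ^+ 2.
have q0 i : 0 <= q i by apply: sumr_ge0 => j _; rewrite exprn_ge0.
have q1 i : q i <= 1.
  have := isometry_row_le1 Wi i; rewrite (bigID (mem J)) /=; apply: le_trans.
  by rewrite lerDl; apply: sumr_ge0 => j _; rewrite exprn_ge0.
pose T i := (lam i - mu) * (q i - (i \in sigma @: J)%:R).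
have T0 i : 0 <= T i.
  rewrite /T; case: (boolP (i \in _)) => [/imsetP[j jJ ->]|/lamN le].
    by rewrite mulr_le0 // subr_le0 ?lamJ.
  by rewrite mulr_ge0 // ?subr0 // subr_ge0.
have sJ (F : 'I_n -> C) : \sum_i F i * (i \in sigma @: J)%:R
    = \sum_(j in J) F (sigma j).
  rewrite -(big_imset F) /=; last by move=> x y _ _ /sI.
  rewrite [RHS]big_mkcond; apply: eq_bigr => i _.
  by case: (i \in _); rewrite ?mulr1 ?mulr0.
have dE : d = \sum_i T i.
  (* The [mu] terms cancel: the row masses [q] and the indicator of [sigma @: J] both sum to
     [#|J|]. *)
  transitivity (\sum_i (lam i * q i - lam i * (i \in sigma @: J)%:R)
     - mu * (\sum_i q i - \sum_i (i \in sigma @: J)%:R)); last first.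
    rewrite -sumrB mulr_sumr -sumrB; apply: eq_bigr => i _.
    by rewrite /T mulrBl !mulrBr.
  have -> : \sum_i q i = #|J|%:R.
    rewrite exchange_big /= (eq_bigr (fun=> 1)) ?sumr_const // => j _.
    exact: isometry_col.
  have -> : \sum_i (i \in sigma @: J)%:R = #|J|%:R :> C.
    under eq_bigr do rewrite -[_%:R]mul1r.
    by rewrite (sJ (fun=> 1)) sumr_const.
  rewrite subrr mulr0 subr0 /d !sumrB sJ; congr (_ - _).
  by rewrite exchange_big; apply: eq_bigr => i _; rewrite mulr_sumr.
split=> [|/eqP]; first by rewrite dE; apply: sumr_ge0.
(* Every term vanishes, so [q i] is the indicator of [sigma @: J] wherever [lam i != mu]; the side
   of [mu] decides membership. *)
rewrite dE => /eqP/psumr_eq0P T00 i; have := T00 (fun i _ => T0 i) i isT.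
move/eqP; rewrite mulf_eq0 subr_eq0 subr_eq0 => Ti; split=> [lt|lt].
  move: Ti; rewrite (lt_eqF lt) /= => /eqP; rewrite -/(q i) => ->.
  by case: (boolP (i \in _)) => // /lamN; rewrite lt_geF.
move: Ti; rewrite (gt_eqF lt) /= => /eqP; rewrite -/(q i) => ->.
case: (boolP (i \in _)) => // /imsetP[j /lamJ le iE].
by move: lt; rewrite iE => /lt_geF; rewrite le.
Qed.

(** * Positive weights: the bound and its equality case *)

Section OneSided.
Variables (C : numClosedFieldType) (n p : nat) (W : 'M[C]_(n, p)).
Variables (lam : 'I_n -> C) (sigma : 'I_p -> 'I_n) (w : 'I_p -> C).
Hypothesis W_iso : W ^t* *m W = 1%:M.
Hypothesis lam_real : forall i, lam i \is Num.real.
Hypothesis sigma_inj : injective sigma.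
Hypothesis w_gt0 : forall j, 0 < w j.
Hypothesis lam_sigma : forall j j',
  w j' < w j -> lam (sigma j) <= lam (sigma j').
Hypothesis lam_out : forall j i, i \notin codom sigma -> lam (sigma j) <= lam i.

(** Diagonal entry of [W^H diag(lam) W] minus its target value. A single gap may be negative; sums
    over upper level sets of [w] are not. *)
Definition rayleigh_gap j := \sum_i lam i * `|W i j| ^+ 2 - lam (sigma j).

Let w_real j : w j \is Num.real. Proof. exact/gtr0_real/w_gt0. Qed.

(** Supplies the [mu] of Ky Fan's inequality as the largest target on the level set. An index
    outside is either the target of a column of smaller weight or no target at all. *)
Lemma level_threshold t : exists j1 : 'I_p,
  [/\ w t <= w j1,
      {in [set j | w t <= w j], forall j, lam (sigma j) <= lam (sigma j1)} &
      forall i, i \notin sigma @: [set j | w t <= w j] ->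
        lam (sigma j1) <= lam i].
Proof.
have ls_real : {in [pred j | w t <= w j], forall j, lam (sigma j) \is Num.real}.
  by move=> j _; apply: lam_real.
case: (real_arg_maxP (i0 := t) (lexx (w t)) ls_real) => j1 tj1 j1max.
exists j1; split=> // [j|i iJ]; first by rewrite inE; apply: j1max.
have [/codomP[j iE]|] := boolP (i \in codom sigma); last exact: lam_out.
rewrite iE; apply: lam_sigma; apply: lt_le_trans tj1.
rewrite real_ltNge //; apply: contra iJ => tj.
by rewrite iE; apply: imset_f; rewrite inE.
Qed.

Lemma level_gap_ge0 t : 0 <= \sum_(j | w t <= w j) rayleigh_gap j.
Proof.
have [j1 [_ le1 ge1]] := level_threshold t.
have [+ _] := ky_fan W_iso sigma_inj lam_real le1 ge1.
by congr (0 <= _); apply: eq_bigl => j; rewrite inE.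
Qed.

(** Equality case of Ky Fan's inequality on one level set. A row of zero mass has zero entries
    there, and an index outside the image cannot lie below the threshold. *)
Lemma level_gap_eq0 t : \sum_(j | w t <= w j) rayleigh_gap j = 0 ->
  exists j1 : 'I_p,
  [/\ w t <= w j1,
      {in [set j | w t <= w j], forall j, lam (sigma j) <= lam (sigma j1)},
      forall i, lam i < lam (sigma j1) ->
        i \in sigma @: [set j | w t <= w j] /\
        \sum_(j | w t <= w j) `|W i j| ^+ 2 = 1 &
      forall i j, lam (sigma j1) < lam i -> w t <= w j -> W i j = 0].
Proof.
move=> gap0; have [j1 [tj1 le1 ge1]] := level_threshold t.
have [_ /=] := ky_fan W_iso sigma_inj lam_real le1 ge1.
rewrite (eq_bigl (fun j => w t <= w j)) => [/(_ gap0) q|j]; last by rewrite inE.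
exists j1; split=> // [i lt|i j lt tj].
  split; first by apply: contraTT lt => /ge1; apply: contraTN => /lt_geF->.
  have [/(_ lt) <- _] := q i.
  by apply: eq_bigl => j; rewrite inE.
have [_ /(_ lt) q0] := q i.
have /psumr_eq0P/(_ q0 j) : forall j, j \in [set j | w t <= w j] ->
  0 <= `|W i j| ^+ 2 by move=> ? _; rewrite exprn_ge0.
by rewrite inE => /(_ tj)/eqP; rewrite sqrf_eq0 normr_eq0 => /eqP.
Qed.

Lemma weighted_gapP : 0 <= \sum_j w j * rayleigh_gap j /\
  (\sum_j w j * rayleigh_gap j = 0 ->
   forall t, \sum_(j | w t <= w j) rayleigh_gap j = 0).
Proof.
have levE t : \sum_(j in [set: 'I_p] | w t <= w j) rayleigh_gap j
    = \sum_(j | w t <= w j) rayleigh_gap j by apply: eq_bigl => j; rewrite inE.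
have totE : \sum_(j in [set: 'I_p]) w j * rayleigh_gap j
    = \sum_j w j * rayleigh_gap j by apply: eq_bigl => j; rewrite inE.
have [||] := @weighted_sum_ge0 _ _ rayleigh_gap w setT.
- by move=> j _; apply: w_gt0.
- by move=> t _; rewrite levE level_gap_ge0.
rewrite totE => ge0 eq0; split=> // /eq0 lev t.
by rewrite -levE lev ?inE.
Qed.

(* The rows of [W] at indices below the threshold [mu] have norm one, so they
   are orthonormal; complete them to a unitary matrix [N].  The columns of
   [W *m N^H] are then basis vectors for the indices below [mu], and vectors
   supported on [lam i = mu] for the others. *)
Lemma gap_eq0_eigenbasis : \sum_j w j * rayleigh_gap j = 0 ->
  exists2 N : 'M[C]_p, N \in unitmx &
    forall i j, lam i * (W *m N) i j = lam (sigma j) * (W *m N) i j.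
Proof.
have [p0 _|p_gt0] := posnP p.
  exists 1%:M => [|i j]; first exact: unitmx1.
  by have := ltn_ord j; rewrite [X in (_ < X)%N]p0.
move/(proj2 weighted_gapP) => lev.
pose j0 := Ordinal p_gt0.
have wr : {in predT, forall j, w j \is Num.real} by [].
(* The level set of a smallest weight consists of all columns. *)
case: (real_arg_minP (i0 := j0) (isT : predT j0) wr) => t _ /(_ _ isT) tmin.
have [j1 [_ le1 lt1 gt1]] := level_gap_eq0 (lev t).
set mu := lam (sigma j1) in le1 lt1 gt1.
have rowsum i : \sum_(j | w t <= w j) `|W i j| ^+ 2 = \sum_j `|W i j| ^+ 2.
  by apply: eq_bigl => j; rewrite tmin.
have row1 i : lam i < mu -> \sum_j `|W i j| ^+ 2 = 1.
  by move=> /lt1[_]; rewrite rowsum.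
pose G := \matrix_(j < p, c < p) W (sigma j) c.
pose J := [set j | lam (sigma j) < mu].
have [a b|N Nu NG] := @unitary_completion _ _ G J.
  rewrite !inE => aJ bJ; have [<-|ab] := eqVneq a b.
    by rewrite -(row1 _ aJ); apply: eq_bigr => c _; rewrite !mxE normCK.
  have sab : sigma a != sigma b by rewrite (inj_eq sigma_inj).
  rewrite -[RHS](isometry_row_ortho W_iso (row1 _ bJ) sab).
  by apply: eq_bigr => c _; rewrite !mxE.
exists (N ^t*) => [|i j]; first by rewrite unitarymx_unit ?trmxC_unitary.
have [->|/eqP Vn0] := eqVneq ((W *m N ^t*) i j) 0; first by rewrite !mulr0.
congr (_ * _).
have VE : (W *m N ^t*) i j = \sum_c W i c * (N j c)^*.
  by rewrite mxE; apply: eq_bigr => c _; rewrite !mxE.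
(* For [j] in [J], row [j] of [N] is row [sigma j] of [W], so column [j] of [W N^H] is a column of
   [W W^H] and vanishes off [sigma j]. *)
have [jJ|jJ] := boolP (lam (sigma j) < mu).
  have [->//|isj] := eqVneq i (sigma j); case: Vn0.
  rewrite VE -[RHS](isometry_row_ortho W_iso (row1 _ jJ) isj).
  by apply: eq_bigr => c _; rewrite NG ?inE // mxE.
have -> : lam (sigma j) = mu.
  apply: le_anti; rewrite le1 ?inE ?tmin //=.
  by rewrite real_leNgt ?jJ //; apply: lam_real.
(* If [lam i < mu], row [i] of [W] is a row of [N] other than row [j], hence orthogonal to it; if
   [lam i > mu], it is zero. *)
have [lt|gt|//] := real_ltgtP (lam_real i) (lam_real (sigma j1)).
  have [/imsetP[j' _ iE] _] := lt1 _ lt; case: Vn0; rewrite VE.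
  have j'J : j' \in J by rewrite inE -iE.
  have jj' : j' != j by apply: contraNneq jJ => <-; rewrite -iE.
  have := congr1 (fun M : 'M_p => M j' j) (unitarymxP Nu).
  rewrite !mxE (negPf jj') => eN; rewrite -[RHS]eN.
  by apply: eq_bigr => c _; rewrite !mxE (NG j') // mxE iE.
case: Vn0; rewrite VE big1 // => c _.
by rewrite gt1 ?tmin ?mul0r.
Qed.

(** For distinct weights, consecutive level sums differ by one gap, so every gap is zero. Column [t]
    lives where [lam i <= lam (sigma t)], and its mean of [lam] equals this maximum, which forces
    equality on the support. *)
Lemma gap_eq0_inj : \sum_j w j * rayleigh_gap j = 0 -> injective w ->
  forall i j, lam i * W i j = lam (sigma j) * W i j.
Proof.
move/(proj2 weighted_gapP) => lev w_inj i t.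
have gapt : rayleigh_gap t = 0.
  have := lev t; rewrite (bigD1 t) //=.
  rewrite (eq_bigl (fun j => w t < w j)); last first.
    by move=> j; rewrite lt_neqAle andbC eq_sym (inj_eq w_inj) eq_sym.
  have [/existsP[u tu]|/existsPn none] := boolP [exists u, w t < w u];
    last first.
    by rewrite big_pred0 ?addr0 // => j; apply/negbTE/none.
  have wr : {in [pred j | w t < w j], forall j, w j \is Num.real} by [].
  (* [w v] is the next weight above [w t], so its level set is the level set of [t] without [t]. *)
  case: (real_arg_minP (i0 := u) tu wr) => v tv vmin.
  rewrite (eq_bigl (fun j => w v <= w j)) ?lev ?addr0 // => j.
  by apply/idP/idP => [/vmin//|]; apply: lt_le_trans.
have [j1 [tj1 _ _ gt1]] := level_gap_eq0 (lev t).
have j1t : lam (sigma j1) <= lam (sigma t).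
  have [/w_inj->//|ne] := eqVneq (w t) (w j1).
  by apply: lam_sigma; rewrite lt_neqAle ne.
have supp a : 0 <= (lam (sigma t) - lam a) * `|W a t| ^+ 2.
  have [le|lt] := real_leP (lam_real a) (lam_real (sigma j1)).
    by rewrite mulr_ge0 ?exprn_ge0 // subr_ge0 (le_trans le).
  by rewrite gt1 // normr0 expr0n mulr0.
have sum0 : \sum_a (lam (sigma t) - lam a) * `|W a t| ^+ 2 = 0.
  under eq_bigr do rewrite mulrBl.
  rewrite sumrB -mulr_sumr (isometry_col W_iso) mulr1 -opprB.
  by rewrite -[LHS]/(- rayleigh_gap t) gapt oppr0.
have /psumr_eq0P/(_ sum0 i isT)/eqP : forall a, true ->
  0 <= (lam (sigma t) - lam a) * `|W a t| ^+ 2 by [].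
rewrite mulf_eq0 subr_eq0 sqrf_eq0 normr_eq0 => /orP[/eqP->//|/eqP->].
by rewrite !mulr0.
Qed.

End OneSided.

(** * Selection of the first and last indices *)

Lemma isometry_colsub (C : numClosedFieldType) n k q (W : 'M[C]_(n, k))
    (h : 'I_q -> 'I_k) :
  W ^t* *m W = 1%:M -> injective h -> (colsub h W) ^t* *m colsub h W = 1%:M.
Proof.
move=> W_iso h_inj; apply/matrixP => a b.
have := congr1 (fun M : 'M_k => M (h a) (h b)) W_iso.
rewrite !mxE (inj_eq h_inj) => e; rewrite -[RHS]e.
by apply: eq_bigr => i _; rewrite !mxE.
Qed.

(** An initial segment of ['I_k] is determined by its cardinality. This turns the counts of positive
    and negative weights into index thresholds. *)
Lemma downset_card k (P : pred 'I_k) :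
  (forall i j : 'I_k, (i <= j)%N -> P j -> P i) ->
  forall i : 'I_k, P i = (i < #|P|)%N.
Proof.
move=> down i.
have card_lt c : (c <= k)%N -> #|[pred j : 'I_k | (j < c)%N]| = c.
  move=> ck; rewrite -sum1_card.
  rewrite (big_ord_narrow_cond (P := xpredT) (F := fun=> 1%N) ck).
  by rewrite sum1_card card_ord.
apply/idP/idP => [Pi|].
  rewrite -(card_lt i.+1) //; apply: subset_leq_card; apply/subsetP => j.
  by rewrite !inE ltnS => /down; apply.
apply: contraLR => Pi; rewrite -leqNgt.
rewrite -[X in (_ <= X)%N](card_lt i (ltnW (ltn_ord i))).
apply: subset_leq_card; apply/subsetP => j; rewrite !inE => Pj.
by rewrite ltnNge; apply: contra Pi => /down; apply.
Qed.

Lemma ext_ord (C : numClosedFieldType) n (f : 'I_n -> C) (i : 'I_n) :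
  ext f i = f i.
Proof. by rewrite /ext valK. Qed.

Section Selection.
Variables (k p m : nat).
Hypothesis pmk : (p + m <= k)%N.

Lemma sel_idx_lt (j : 'I_(p + m)) : (sel_idx k p m j < k)%N.
Proof. by rewrite /sel_idx; have := ltn_ord j; case: ifP; lia. Qed.

(** The same embedding serves for columns (in ['I_k]) and for eigenvalue indices (in ['I_n]), which
    pairs them by position. *)
Definition sel_ord j : 'I_k := Ordinal (sel_idx_lt j).

Lemma sel_ord_inj : injective sel_ord.
Proof.
move=> a b /(congr1 val) /=; rewrite /sel_idx => e; apply: val_inj => /=.
by move: e (ltn_ord a) (ltn_ord b); do 2 case: ifP; lia.
Qed.

Lemma sel_ord_lshift (t : 'I_p) : sel_ord (lshift m t) = t :> nat.
Proof. by rewrite /= /sel_idx ltn_ord. Qed.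

Lemma sel_ord_rshift (t : 'I_m) : sel_ord (rshift p t) = (k - m + t)%N :> nat.
Proof. by rewrite /= /sel_idx ltnNge leq_addr /= addKn. Qed.

Lemma sel_ord_codom (j : 'I_k) :
  (j \in codom sel_ord) = (j < p)%N || (k - m <= j)%N.
Proof.
apply/codomP/orP => [[a ->]|].
  by rewrite /= /sel_idx; have := ltn_ord a; case: ifP; [left|right]; lia.
case=> hj.
  by exists (lshift m (Ordinal hj)); apply: ord_inj; rewrite sel_ord_lshift.
have jm : (j - (k - m) < m)%N by have := ltn_ord j; lia.
exists (rshift p (Ordinal jm)); apply: ord_inj; rewrite sel_ord_rshift /=.
by rewrite subnKC.
Qed.

Lemma sum_sel_ord (V : nmodType) (F : 'I_k -> V) :
  (forall j : 'I_k, (p <= j)%N -> (j < k - m)%N -> F j = 0) ->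
  \sum_j F j = \sum_j F (sel_ord j).
Proof.
move=> F0; rewrite (bigID (mem (codom sel_ord))) /= [X in _ + X]big1 ?addr0.
  by rewrite -big_uniq /= ?big_image //; apply/injectiveP/sel_ord_inj.
move=> j; rewrite sel_ord_codom negb_or -leqNgt -ltnNge => /andP[pj jm].
exact: F0.
Qed.

Lemma mulmx_colsel (C : numClosedFieldType) n (W : 'M[C]_(n, k)) :
  W *m colsel C k p m (p + m) = colsub sel_ord W.
Proof.
apply/matrixP => i j; rewrite !mxE (bigD1 (sel_ord j)) //= mxE eqxx mulr1.
rewrite big1 ?addr0 // => c cj; rewrite mxE.
suff /negPf-> : nat_of_ord c != sel_idx k p m j by rewrite mulr0.
by apply: contra cj => /eqP e; apply/eqP/val_inj.
Qed.

Lemma extreme_eigsE (C : numClosedFieldType) (lam : 'I_k -> C) :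
  extreme_eigs lam p m (p + m) = \row_j lam (sel_ord j).
Proof.
apply/rowP => j; rewrite !mxE -ext_ord /= /sel_idx.
by case: ifP.
Qed.

End Selection.

(** * Weights of both signs *)

Section TwoSided.
Variables (C : numClosedFieldType) (n k p m : nat) (W : 'M[C]_(n, k)).
Variables (lam : 'I_n -> C) (omega : 'I_k -> C).
Hypotheses (pmk : (p + m <= k)%N) (pmn : (p + m <= n)%N).
Hypothesis W_iso : W ^t* *m W = 1%:M.
Hypothesis lam_real : forall i, lam i \is Num.real.
Hypothesis lam_mono : forall i j : 'I_n, (i <= j)%N -> lam i <= lam j.
Hypothesis omega_anti : forall i j : 'I_k, (i <= j)%N -> omega j <= omega i.
Hypothesis omega_gt0 : forall i : 'I_k, (0 < omega i) = (i < p)%N.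
Hypothesis omega_lt0 : forall i : 'I_k, (omega i < 0) = (k - m <= i)%N.

Local Notation h := (sel_ord pmk).
Local Notation s := (sel_ord pmn).
Local Notation Y := (colsub h W).

Let Y_iso : Y ^t* *m Y = 1%:M.
Proof. exact: isometry_colsub W_iso (@sel_ord_inj _ _ _ pmk). Qed.

Let lsub_iso : (lsubmx Y) ^t* *m lsubmx Y = 1%:M.
Proof.
rewrite (_ : lsubmx Y = colsub (@lshift p m) Y); last first.
  by apply/matrixP => i j; rewrite !mxE.
exact: isometry_colsub Y_iso (@lshift_inj _ _).
Qed.

Let rsub_iso : (rsubmx Y) ^t* *m rsubmx Y = 1%:M.
Proof.
rewrite (_ : rsubmx Y = colsub (@rshift p m) Y); last first.
  by apply/matrixP => i j; rewrite !mxE.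
exact: isometry_colsub Y_iso (@rshift_inj _ _).
Qed.

(** The left block has positive weights and the smallest eigenvalues as targets. On the right block
    weights and eigenvalues are both negated, which keeps their products and gives the one-sided
    hypotheses. *)
Let lw t := omega (h (lshift m t)).
Let ls t := s (lshift m t).
Let rw t := - omega (h (rshift p t)).
Let rs t := s (rshift p t).

Let lw_gt0 t : 0 < lw t.
Proof. by rewrite omega_gt0 sel_ord_lshift. Qed.

Let rw_gt0 t : 0 < rw t.
Proof. by rewrite oppr_gt0 omega_lt0 sel_ord_rshift leq_addr. Qed.

Let ls_inj : injective ls.
Proof. by move=> a b /sel_ord_inj/lshift_inj. Qed.

Let rs_inj : injective rs.
Proof. by move=> a b /sel_ord_inj/rshift_inj. Qed.

Let ls_mono j j' : lw j' < lw j -> lam (ls j) <= lam (ls j').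
Proof.
move=> lt; apply: lam_mono; rewrite !sel_ord_lshift leqNgt.
apply: contraTN lt => jj'; apply/negbT/le_gtF/omega_anti.
by rewrite !sel_ord_lshift ltnW.
Qed.

Let rs_mono j j' : rw j' < rw j -> - lam (rs j) <= - lam (rs j').
Proof.
move=> lt; rewrite lerN2; apply: lam_mono.
rewrite !sel_ord_rshift leq_add2l leqNgt.
apply: contraTN lt => jj'; rewrite ltrN2; apply/negbT/le_gtF/omega_anti.
by rewrite !sel_ord_rshift leq_add2l ltnW.
Qed.

Let ls_out j i : i \notin codom ls -> lam (ls j) <= lam i.
Proof.
move=> iN; apply: lam_mono; rewrite sel_ord_lshift.
apply/ltnW/(leq_trans (ltn_ord j)).
rewrite leqNgt; apply: contra iN => ip.
by apply/codomP; exists (Ordinal ip); apply: ord_inj; rewrite sel_ord_lshift.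
Qed.

Let rs_out j i : i \notin codom rs -> - lam (rs j) <= - lam i.
Proof.
move=> iN; rewrite lerN2; apply: lam_mono; rewrite sel_ord_rshift.
apply: (leq_trans _ (leq_addr _ _)); rewrite leqNgt; apply: contra iN => ip.
have im : (i - (n - m) < m)%N by have := ltn_ord i; lia.
apply/codomP; exists (Ordinal im); apply: ord_inj; rewrite sel_ord_rshift /=.
by rewrite subnKC // ltnW.
Qed.

Let nlam_real i : - lam i \is Num.real.
Proof. by rewrite rpredN. Qed.

Let lP := weighted_gapP lsub_iso lam_real ls_inj lw_gt0 ls_mono ls_out.
Let rP := weighted_gapP rsub_iso nlam_real rs_inj rw_gt0 rs_mono rs_out.

Let gapE : \sum_j omega (h j) * rayleigh_gap Y lam s j =
  \sum_t lw t * rayleigh_gap (lsubmx Y) lam ls t +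
  \sum_t rw t * rayleigh_gap (rsubmx Y) (fun i => - lam i) rs t.
Proof.
rewrite big_split_ord /=; congr (_ + _); apply: eq_bigr => t _.
  by congr (_ * (_ - _)); apply: eq_bigr => i _; rewrite !mxE.
rewrite mulNr -mulrN; congr (_ * _); rewrite /rayleigh_gap opprB [RHS]addrC.
congr (_ - _); rewrite -sumrN; apply: eq_bigr => i _.
by rewrite !mxE mulNr opprK.
Qed.

Lemma two_sided_ge0 : 0 <= \sum_j omega (h j) * rayleigh_gap Y lam s j.
Proof. by rewrite gapE addr_ge0 // ?(proj1 lP) ?(proj1 rP). Qed.

(** Both one-sided sums are nonnegative, so both vanish; the two changes of basis combine into a
    block diagonal one. *)
Lemma two_sided_eq0 : \sum_j omega (h j) * rayleigh_gap Y lam s j = 0 ->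
  (exists2 N : 'M[C]_(p + m), N \in unitmx &
     forall i j, lam i * (Y *m N) i j = lam (s j) * (Y *m N) i j) /\
  ((forall i j : 'I_k, omega i != 0 -> omega i = omega j -> i = j) ->
     forall i j, lam i * Y i j = lam (s j) * Y i j).
Proof.
move/eqP; rewrite gapE paddr_eq0 ?(proj1 lP) ?(proj1 rP) //.
case/andP=> /eqP l0 /eqP r0; split.
  have [Nl Nlu lE] := gap_eq0_eigenbasis lsub_iso lam_real ls_inj
    lw_gt0 ls_mono ls_out l0.
  have [Nr Nru rE] := gap_eq0_eigenbasis rsub_iso nlam_real rs_inj
    rw_gt0 rs_mono rs_out r0.
  exists (block_mx Nl 0 0 Nr) => [|i j].
    by rewrite unitmxE det_ublock unitrM -!unitmxE Nlu.
  rewrite -{1 2}[Y]hsubmxK mul_row_block !mulmx0 addr0 add0r.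
  case: (splitP j) => t jt.
    have -> : j = lshift m t by apply: ord_inj.
    by rewrite row_mxEl lE.
  have -> : j = rshift p t by apply: ord_inj.
  by rewrite row_mxEr; apply: oppr_inj; rewrite -!mulNr rE.
move=> omega_inj i j.
(* Selected columns have nonzero weight, so distinctness of the nonzero weights suffices. *)
have lw_inj : injective lw.
  move=> a b /omega_inj; rewrite gt_eqF ?lw_gt0 // => /(_ isT).
  by move/sel_ord_inj/lshift_inj.
have rw_inj : injective rw.
  move=> a b /oppr_inj/omega_inj.
  rewrite lt_eqF -?oppr_gt0 ?rw_gt0 // => /(_ isT).
  by move/sel_ord_inj/rshift_inj.
have lE := gap_eq0_inj lsub_iso lam_real ls_inj lw_gt0 ls_mono ls_out l0 lw_inj.
have rE := gap_eq0_inj rsub_iso nlam_real rs_inj rw_gt0 rs_mono rs_out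
  r0 rw_inj.
case: (splitP j) => t jt.
  have -> : j = lshift m t by apply: ord_inj.
  by have := lE i t; rewrite !mxE.
have -> : j = rshift p t by apply: ord_inj.
by have := rE i t; rewrite !mxE !mulNr => /oppr_inj.
Qed.

End TwoSided.

(** * Reduction of the pencil to diagonal form *)

Lemma adjmxM (C : numClosedFieldType) a b c
    (M : 'M[C]_(a, b)) (N : 'M[C]_(b, c)) :
  (M *m N) ^t* = N ^t* *m M ^t*.
Proof. by rewrite trmx_mul map_mxM. Qed.

Lemma trace_diag_rayleigh (C : numClosedFieldType) n k (W : 'M[C]_(n, k))
    (lam : 'I_n -> C) (omega : 'I_k -> C) :
  \tr (diag_mx (\row_j omega j) *m (W ^t* *m diag_mx (\row_i lam i) *m W)) =
  \sum_j omega j * \sum_i lam i * `|W i j| ^+ 2.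
Proof.
apply: eq_bigr => j _; rewrite mul_diag_mx !mxE; congr (_ * _).
apply: eq_bigr => i _; rewrite mul_mx_diag !mxE normCKC.
by rewrite mulrA [lam i * _]mulrC.
Qed.

Section Pencil.
Variables (C : numClosedFieldType) (n k : nat).
Variables (A B U : 'M[C]_n) (D Q : 'M[C]_k).
Variables (lam : 'I_n -> C) (omega : 'I_k -> C).
Hypothesis kn : (k <= n)%N.
Hypothesis A_herm : hermitianmx A.
Hypothesis lam_mono : forall i j : 'I_n, (i <= j)%N -> lam i <= lam j.
Hypothesis UAU : U ^t* *m A *m U = diag_mx (\row_i lam i).
Hypothesis UBU : U ^t* *m B *m U = 1%:M.
Hypothesis Q_unitary : Q \is unitarymx.
Hypothesis QDQ : Q ^t* *m D *m Q = diag_mx (\row_i omega i).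
Hypothesis omega_anti : forall i j : 'I_k, (i <= j)%N -> omega j <= omega i.

Let Lam := diag_mx (\row_i lam i).
Local Notation feasible X := (X ^t* *m B *m X = 1%:M).

Let QQ : Q *m Q ^t* = 1%:M. Proof. exact/unitarymxP. Qed.
Let QtQ : Q ^t* *m Q = 1%:M. Proof. exact: mulmx1C QQ. Qed.

Lemma pencil_eig_real i : lam i \is Num.real.
Proof.
apply/CrealP; have := congr1 (fun M => M ^t*) UAU.
rewrite !adjmxM trmxCK A_herm mulmxA UAU.
move=> /(congr1 (fun M : 'M_n => M i i)); rewrite !mxE eqxx !mulr1n.
by move<-.
Qed.

(* Feasible [X] correspond to isometries [W] with [X *m Q = U *m W]. *)
Definition reduced (X : 'M[C]_(n, k)) := invmx U *m X *m Q.

Let U_unit : U \in unitmx. Proof. by have [] := mulmx1_unit UBU. Qed.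

Lemma mul_reduced X : U *m reduced X = X *m Q.
Proof. by rewrite /reduced !mulmxA mulmxV // mul1mx. Qed.

(** As [U^H B U = 1], the Gram matrix of [W] is that of [U W = X Q] for the inner product of [B]. *)
Lemma reduced_isometry X : feasible X -> (reduced X) ^t* *m reduced X = 1%:M.
Proof.
move=> fX; rewrite -[LHS]mulmx1 -QtQ.
have -> : (reduced X) ^t* *m reduced X =
    (U *m reduced X) ^t* *m B *m (U *m reduced X).
  rewrite adjmxM !mulmxA -[_ *m U ^t* *m B]mulmxA.
  by rewrite -[_ *m _ *m U]mulmxA UBU mulmx1.
rewrite mul_reduced adjmxM !mulmxA -[_ *m X ^t* *m B]mulmxA.
by rewrite -[_ *m _ *m X]mulmxA fX mulmx1 QtQ mul1mx QtQ.
Qed.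

(** Both matrices become diagonal, and [Q Q^H] cancels by cyclicity of the trace. *)
Lemma trace_reduced X :
  \tr (D *m X ^t* *m A *m X) =
  \sum_j omega j * \sum_i lam i * `|reduced X i j| ^+ 2.
Proof.
rewrite -trace_diag_rayleigh -QDQ -UAU.
have -> : (reduced X)^t* *m (U^t* *m A *m U) *m reduced X
   = Q ^t* *m (X ^t* *m A *m X *m Q).
  transitivity ((U *m reduced X) ^t* *m A *m (U *m reduced X)).
    by rewrite adjmxM !mulmxA.
  by rewrite mul_reduced adjmxM !mulmxA.
rewrite -[Q ^t* *m D *m Q *m _]mulmxA [Q *m _]mulmxA QQ mul1mx.
rewrite -[in RHS]mulmxA [in RHS]mxtrace_mulC !mulmxA.
by rewrite -[_ *m Q *m Q ^t*]mulmxA QQ mulmx1.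
Qed.

(** Inverse of the change of variables, used to exhibit a minimizer. *)
Lemma feasible_lift (W : 'M[C]_(n, k)) : W ^t* *m W = 1%:M ->
  feasible (U *m W *m Q ^t*) /\ reduced (U *m W *m Q ^t*) = W.
Proof.
move=> W_iso; split; last first.
  by rewrite /reduced !mulmxA mulVmx // mul1mx -mulmxA QtQ mulmx1.
rewrite !adjmxM trmxCK !mulmxA.
rewrite -[_ *m U ^t* *m B]mulmxA -[_ *m _ *m U]mulmxA UBU mulmx1.
by rewrite -[_ *m W ^t* *m W]mulmxA W_iso mulmx1 QQ.
Qed.

(** * The minimum value and the structure of minimizers *)

Section Value.
Variable l : nat.
Hypothesis omega_ge0 : forall i : 'I_k, (i < l)%N -> 0 <= omega i.
Hypothesis omega_le0 : forall i : 'I_k, (l <= i)%N -> omega i <= 0.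

Definition opt_eig (i : 'I_k) :=
  if (i < l)%N then ext lam i else ext lam (i + n - k).

Lemma opt_attained : exists X, feasible X /\
  \tr (D *m X ^t* *m A *m X) = \sum_i omega i * opt_eig i.
Proof.
have lt (i : 'I_k) : ((if i < l then i : nat else i + n - k) < n)%N.
  by have := ltn_ord i; case: ifP; lia.
pose sigma i := Ordinal (lt i).
have sigma_inj : injective sigma.
  move=> a b /(congr1 val) /= e; apply: ord_inj; move: e.
  by have := ltn_ord a; have := ltn_ord b; do 2 case: ifP; lia.
(* The columns of [W] are the standard basis vectors at the indices occurring in [opt_eig]. *)
pose W : 'M[C]_(n, k) := colsub sigma 1%:M.
have W_iso : W ^t* *m W = 1%:M.
  by apply: isometry_colsub sigma_inj; rewrite trmx1 map_mx1 mulmx1.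
have [fX rX] := feasible_lift W_iso.
exists (U *m W *m Q ^t*); split=> //; rewrite trace_reduced rX.
apply: eq_bigr => j _; congr (_ * _).
rewrite (bigD1 (sigma j)) //= !mxE eqxx normr1 expr1n mulr1 big1 ?addr0.
  by rewrite -ext_ord /opt_eig /=; case: ifP.
by move=> i /negPf ne; rewrite !mxE ne normr0 expr0n mulr0.
Qed.

Section Counts.
Variables (p m : nat).
Hypothesis pmk : (p + m <= k)%N.
Hypothesis omega_gt0 : forall i : 'I_k, (0 < omega i) = (i < p)%N.
Hypothesis omega_lt0 : forall i : 'I_k, (omega i < 0) = (k - m <= i)%N.

Let pmn : (p + m <= n)%N. Proof. exact: leq_trans pmk kn. Qed.
Local Notation h := (sel_ord pmk).
Local Notation s := (sel_ord pmn).

(** The order of [C] is partial, so a number neither positive nor negative need not be zero; the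
    threshold [l] makes each weight comparable with 0. *)
Lemma omega_eq0 (i : 'I_k) : (p <= i)%N -> (i < k - m)%N -> omega i = 0.
Proof.
move=> pi im; have := omega_lt0 i; have := omega_gt0 i.
rewrite [(k - m <= i)%N]leqNgt im [(i < p)%N]ltnNge pi /= !lt_neqAle eq_sym.
have [->//|n0 /= g0 l0] := eqVneq (omega i) 0.
have [/omega_ge0|/omega_le0] := ltnP i l; first by rewrite g0.
by rewrite l0.
Qed.

(** The split at [l] in [opt_eig] may differ from [p] and [k - m], but only at zero weights: a
    positive weight sits below [l] and a negative one at or beyond it. *)
Lemma trace_gap X : \tr (D *m X ^t* *m A *m X) - \sum_i omega i * opt_eig i =
  \sum_j omega (h j) * rayleigh_gap (colsub h (reduced X)) lam s j.
Proof.
rewrite trace_reduced -sumrB.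
under eq_bigr do rewrite -mulrBr.
rewrite (sum_sel_ord pmk) => [|j pj jm]; last by rewrite omega_eq0 ?mul0r.
apply: eq_bigr => j _; congr (_ * (_ - _)).
  by apply: eq_bigr => i _; rewrite [colsub _ _ _ _]mxE.
rewrite -[RHS]ext_ord /opt_eig; case: (splitP j) => t jt.
  have -> : j = lshift m t by apply: ord_inj.
  rewrite !sel_ord_lshift; case: ltnP => // lt.
  have := omega_le0 (i := h (lshift m t)); rewrite sel_ord_lshift => /(_ lt).
  by move/le_gtF; rewrite omega_gt0 sel_ord_lshift ltn_ord.
have -> : j = rshift p t by apply: ord_inj.
rewrite !sel_ord_rshift; case: ltnP => [lt|_]; last by congr ext; lia.
have := omega_ge0 (i := h (rshift p t)); rewrite sel_ord_rshift => /(_ lt).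
by move/le_gtF; rewrite omega_lt0 sel_ord_rshift leq_addr.
Qed.

Lemma opt_lower_bound X : feasible X ->
  \sum_i omega i * opt_eig i <= \tr (D *m X ^t* *m A *m X).
Proof.
move/reduced_isometry => W_iso; rewrite -subr_ge0 trace_gap.
exact: two_sided_ge0 W_iso pencil_eig_real lam_mono omega_anti
  omega_gt0 omega_lt0.
Qed.

(** The equality case is carried back through [U]. The size [q] is separate from [p + m] so that it
    can be [k] itself when [p = l] and [m = k - l]. *)
Lemma opt_structure q X (Y := X *m (Q *m colsel C k p m q)) :
  (p + m)%N = q -> feasible X ->
  \tr (D *m X ^t* *m A *m X) = \sum_i omega i * opt_eig i ->
  (exists V : 'M[C]_(n, q), same_range V Y /\
     A *m V = B *m V *m diag_mx (extreme_eigs lam p m q)) /\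
  ((forall i j : 'I_k, omega i != 0 -> omega i = omega j -> i = j) ->
     Y ^t* *m A *m Y = diag_mx (extreme_eigs lam p m q)).
Proof.
move=> qE; move: @Y; case: q / qE => Y fX /eqP.
rewrite -subr_eq0 trace_gap => /eqP gap0.
have W_iso := reduced_isometry fX.
have [eigV eigY] := two_sided_eq0 W_iso pencil_eig_real lam_mono omega_anti
  omega_gt0 omega_lt0 gap0.
set Z := colsub h (reduced X) in eigV eigY.
have YE : Y = U *m Z by rewrite /Y mulmxA -mul_reduced -mulmxA mulmx_colsel.
have Z_iso : Z ^t* *m Z = 1%:M.
  exact: isometry_colsub W_iso (@sel_ord_inj _ _ _ pmk).
have eigM (M : 'M[C]_(n, p + m)) :
    (forall i j, lam i * M i j = lam (s j) * M i j) ->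
    Lam *m M = M *m diag_mx (extreme_eigs lam p m (p + m)).
  move=> eM; apply/matrixP => i j; rewrite (extreme_eigsE pmn).
  by rewrite mul_diag_mx mul_mx_diag !mxE eM mulrC.
split=> [|omega_inj]; last first.
  rewrite YE adjmxM !mulmxA -[_ *m U ^t* *m A]mulmxA -[_ *m _ *m U]mulmxA UAU.
  by rewrite -mulmxA (eigM _ (eigY omega_inj)) mulmxA Z_iso mul1mx.
have [N N_unit NE] := eigV.
exists (U *m (Z *m N)); split.
  rewrite YE mulmxA /same_range trmx_mul.
  by apply/eqmxP/eqmxMfull; rewrite row_full_unit unitmx_tr.
have Ut_unit : U ^t* \in unitmx.
  by move: UBU; rewrite -mulmxA => /mulmx1_unit[].
(* Multiplication by the invertible [U^H] turns the pencil equation into the diagonal one for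
   [Z N]. *)
apply: (can_inj (mulKmx Ut_unit)).
rewrite !mulmxA UAU UBU mul1mx -!mulmxA [in RHS]mulmxA.
exact: eigM NE.
Qed.

End Counts.
End Value.
End Pencil.

Theorem theorem2p1 (C : numClosedFieldType) (n k : nat)
  (A B : 'M[C]_n) (D : 'M[C]_k)
  (lam : 'I_n -> C) (U : 'M[C]_n)
  (omega : 'I_k -> C) (Q : 'M[C]_k) (l : nat) :
  (k <= n)%N ->
  hermitianmx A -> posdefmx B -> hermitianmx D ->
  (forall i j : 'I_n, (i <= j)%N -> lam i <= lam j) ->
  U ^t* *m A *m U = diag_mx (\row_i lam i) ->
  U ^t* *m B *m U = 1%:M ->
  Q \is unitarymx ->
  Q ^t* *m D *m Q = diag_mx (\row_i omega i) ->
  (l <= k)%N ->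
  (forall i j : 'I_k, (i <= j)%N -> omega j <= omega i) ->
  (forall i : 'I_k, (i < l)%N -> 0 <= omega i) ->
  (forall i : 'I_k, (l <= i)%N -> omega i <= 0) ->
  let opt := \sum_(i < k)
      omega i * (if (i < l)%N then ext lam i else ext lam (i + n - k)) in
  let feasible (X : 'M[C]_(n, k)) := X ^t* *m B *m X = 1%:M in
  let minimizer (X : 'M[C]_(n, k)) :=
      feasible X /\ forall Y, feasible Y ->
        \tr (D *m X ^t* *m A *m X) <= \tr (D *m Y ^t* *m A *m Y) in
  let lp := #|[pred i : 'I_k | 0 < omega i]| in
  let lm := #|[pred i : 'I_k | omega i < 0]| in
  let Qh := Q *m colsel C k lp lm (lp + lm) in
  (* the minimum value: attained, and a lower bound on the feasible set *)
  ((exists X, feasible X /\ \tr (D *m X ^t* *m A *m X) = opt) /\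
   (forall X, feasible X -> opt <= \tr (D *m X ^t* *m A *m X))) /\
  (* (a) *)
  (\det D != 0 -> forall X, minimizer X ->
     (exists V : 'M[C]_(n, k),
        same_range V (X *m Q) /\
        A *m V = B *m V *m diag_mx (extreme_eigs lam l (k - l) k)) /\
     ((forall i j : 'I_k, omega i = omega j -> i = j) ->
        (X *m Q) ^t* *m A *m (X *m Q) =
          diag_mx (extreme_eigs lam l (k - l) k))) /\
  (* (b) *)
  (forall X, minimizer X ->
     (exists V : 'M[C]_(n, lp + lm),
        same_range V (X *m Qh) /\
        A *m V = B *m V *m diag_mx (extreme_eigs lam lp lm (lp + lm))) /\
     ((forall i j : 'I_k, omega i != 0 -> omega i = omega j -> i = j) ->
        (X *m Qh) ^t* *m A *m (X *m Qh) =
          diag_mx (extreme_eigs lam lp lm (lp + lm)))).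
Proof.
move=> kn A_herm _ _ lam_mono UAU UBU Q_unit QDQ lk.
move=> omega_anti omega_ge0 omega_le0.
move=> opt feasible minimizer lp lm Qh.
have lpE (i : 'I_k) : (0 < omega i) = (i < lp)%N.
  apply: (downset_card (P := [pred i | 0 < omega i])) => a b ab /= b0.
  exact: lt_le_trans b0 (omega_anti _ _ ab).
(* Negative weights form a final segment, so the count is applied to the complement. *)
have lmE (i : 'I_k) : (omega i < 0) = (k - lm <= i)%N.
  have <- : #|[pred i | ~~ (omega i < 0)]| = (k - lm)%N.
    rewrite -[X in (X - _)%N]card_ord -(cardC [pred i | omega i < 0]) addKn.
    exact: eq_card.
  rewrite leqNgt; apply: negb_inj; rewrite negbK.
  apply: (downset_card (P := [pred i | ~~ (omega i < 0)])) => a b ab /=.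
  by apply: contra; apply: le_lt_trans (omega_anti _ _ ab).
have lpmk : (lp + lm <= k)%N.
  (* Otherwise the weight at index [k - lm] would be both positive and negative. *)
  rewrite leqNgt; apply/negP => gt.
  have lpk : (lp <= k)%N by rewrite -[leqRHS]card_ord max_card.
  have lmk : (lm <= k)%N by rewrite -[leqRHS]card_ord max_card.
  have ik : (k - lm < k)%N by lia.
  have := lmE (Ordinal ik); rewrite leqnn => /lt_gtF.
  by rewrite lpE /=; lia.
have [X0 [fX0 trX0]] := opt_attained kn UAU UBU Q_unit QDQ l.
have lower X : feasible X -> opt <= \tr (D *m X ^t* *m A *m X).
  exact (opt_lower_bound kn A_herm lam_mono UAU UBU Q_unit QDQ omega_anti
    omega_ge0 omega_le0 lpmk lpE lmE (X := X)).
have minE X : minimizer X -> \tr (D *m X ^t* *m A *m X) = opt.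
  case=> fX minX; apply: le_anti; rewrite lower // andbT.
  by rewrite -[leRHS]trX0 minX.
split; first by split; [exists X0|].
split=> [D_unit X minX|X minX]; last first.
  have [fX _] := minX.
  exact (opt_structure kn A_herm lam_mono UAU UBU Q_unit QDQ omega_anti
    omega_ge0 omega_le0 lpmk lpE lmE erefl fX (minE X minX)).
(* The determinant of [Q^H D Q] is the product of the weights; with none zero, [l] and [k - l] are
   the exact sign counts. *)
have omega_n0 i : omega i != 0.
  have : \det (Q ^t* *m D *m Q) != 0.
    have Qd : \det Q != 0 by rewrite -unitfE -unitmxE unitarymx_unit.
    by rewrite !det_mulmx !mulf_neq0 // det_map_mx det_tr fmorph_eq0.
  rewrite QDQ det_diag; apply: contraNneq => i0.
  by rewrite (bigD1 i) //= mxE i0 mul0r.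
have lE (i : 'I_k) : (0 < omega i) = (i < l)%N.
  have [il|li] := ltnP i l; first by rewrite lt0r omega_n0 omega_ge0.
  exact/le_gtF/omega_le0.
have klE (i : 'I_k) : (omega i < 0) = (k - (k - l) <= i)%N.
  rewrite subKn //; have [li|il] := leqP l i; last exact/le_gtF/omega_ge0.
  by rewrite lt_neqAle omega_n0 omega_le0.
have [fX _] := minX.
have [eqk lek] : (l + (k - l))%N = k /\ (l + (k - l) <= k)%N by rewrite subnKC.
have := opt_structure kn A_herm lam_mono UAU UBU Q_unit QDQ omega_anti
    omega_ge0 omega_le0 lek lE klE eqk fX (minE X minX).
(* The first [l] and last [k - l] of [k] columns are all of them, in order. *)
have -> : colsel C k l (k - l) k = 1%:M.
  apply/matrixP => i j; rewrite !mxE /sel_idx subKn //; congr (_ == _)%:R.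
  by case: ltnP => // lj; rewrite subnKC.
rewrite mulmx1 => -[eigV eigX]; split=> // omega_inj.
by apply: eigX => i j _; apply: omega_inj.
Qed.
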